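(* Let $m,n\ge2$, let $\mathcal{A}\in\mathbb{R}^{m\times n\times m\times n}$ be a biquadratic tensor, and fix parameters $\eta\in(0,2)$, $\beta\in(0,1)$, $0<C_L\le1\le C_U$. There exists a positive constant $M$ with $|f(\mathbf{z})|\le M$, $\|\nabla f(\mathbf{z})\|\le M$, $\|\nabla^2f(\mathbf{z})\|\le M$ for all $\mathbf{z}=(\mathbf{x}^\top,\mathbf{y}^\top)^\top$ with $\mathbf{x}^\top\mathbf{x}=\mathbf{y}^\top\mathbf{y}=1$ such that, with $\hat\alpha=\frac{(2-\eta)C_L}{(2+\eta)MC_U^2}$ and $\alpha_{\min}=\beta\hat\alpha$, every sequence $\{\mathbf{z}^{(k)}\}$ generated by the Riemannian LBFGS algorithm (described in the context) satisfies, for all $k\ge0$, $$f(\mathbf{z}^{(k+1)})-f(\mathbf{z}^{(k)})\le-\eta\,\alpha_{\min}C_L\|\nabla f(\mathbf{z}^{(k)})\|^2.$$ Furthermore, the objective values $f(\mathbf{z}^{(k)})$ converge monotonically to a constant value, and $$\lim_{k\to+\infty}\|\nabla f(\mathbf{z}^{(k)})\|=0.$$ Namely, any limit point of the sequence $\{\mathbf{z}^{(k)}\}$ is a KKT point of the problem of minimizing $f(\mathbf{z})$ over $\mathbf{x}\in\mathbb{R}^m$, $\mathbf{y}\in\mathbb{R}^n$ subject to $\mathbf{x}^\top\mathbf{x}=1$, $\mathbf{y}^\top\mathbf{y}=1$, and it also gives an M-eigenpair of $\mathcal{A}$.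
   Context: Write $[n]=\{1,\dots,n\}$. A biquadratic tensor is a real tensor $\mathcal{A}=(a_{i_1j_1i_2j_2})\in\mathbb{R}^{m\times n\times m\times n}$, $i_1,i_2\in[m]$, $j_1,j_2\in[n]$, $m,n\ge2$ (no symmetry assumed). Write $\mathcal{A}\mathbf{x}\mathbf{y}\mathbf{x}\mathbf{y}=\sum a_{i_1j_1i_2j_2}x_{i_1}y_{j_1}x_{i_2}y_{j_2}$. A real $\lambda$ is an M-eigenvalue of $\mathcal{A}$ with M-eigenvectors $\mathbf{x}\in\mathbb{R}^m$, $\mathbf{y}\in\mathbb{R}^n$ if $\mathbf{x}^\top\mathbf{x}=\mathbf{y}^\top\mathbf{y}=1$, for every $i\in[m]$: $\sum_{i_1,j_1,j_2}a_{i_1j_1ij_2}x_{i_1}y_{j_1}y_{j_2}+\sum_{i_2,j_1,j_2}a_{ij_1i_2j_2}y_{j_1}x_{i_2}y_{j_2}=2\lambda x_i$, and for every $j\in[n]$: $\sum_{i_1,i_2,j_1}a_{i_1j_1i_2j}x_{i_1}y_{j_1}x_{i_2}+\sum_{i_1,i_2,j_2}a_{i_1ji_2j_2}x_{i_1}x_{i_2}y_{j_2}=2\lambda y_j$. At a KKT point $(\mathbf{x},\mathbf{y})$ the associated M-eigenvalue is $\lambda=\mathcal{A}\mathbf{x}\mathbf{y}\mathbf{x}\mathbf{y}$. Objective: for $\mathbf{z}=(\mathbf{x}^\top,\mathbf{y}^\top)^\top\in\mathbb{R}^{m+n}$ with $\mathbf{x},\mathbf{y}\neq0$, $f(\mathbf{z})=\frac{\mathcal{A}\mathbf{x}\mathbf{y}\mathbf{x}\mathbf{y}}{(\mathbf{x}^\top\mathbf{x})(\mathbf{y}^\top\mathbf{y})}$;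 $\nabla_{\mathbf{x}}f,\nabla_{\mathbf{y}}f$ are the $\mathbf{x}$- and $\mathbf{y}$-blocks of its gradient $\nabla f$. Riemannian LBFGS algorithm. Start from unit vectors $\mathbf{x}^{(0)},\mathbf{y}^{(0)}$. At step $k$, let $H^{(k)}\in\mathbb{R}^{(m+n)\times(m+n)}$ be the standard limited-memory BFGS quasi-Newton matrix, and let $\mathbf{p}^{(k)}=(\mathbf{p}_{\mathbf{x}}^{(k)},\mathbf{p}_{\mathbf{y}}^{(k)})$ be $-H^{(k)}\nabla f(\mathbf{z}^{(k)})$ if this vector satisfies, for both $\mathbf{w}=\mathbf{x}$ and $\mathbf{w}=\mathbf{y}$, $$(\mathbf{p}_{\mathbf{w}}^{(k)})^\top\nabla_{\mathbf{w}}f(\mathbf{z}^{(k)})\le-C_L\|\nabla_{\mathbf{w}}f(\mathbf{z}^{(k)})\|^2,\qquad\|\mathbf{p}_{\mathbf{w}}^{(k)}\|\le C_U\|\nabla_{\mathbf{w}}f(\mathbf{z}^{(k)})\|,$$ and otherwise $\mathbf{p}^{(k)}=-\nabla f(\mathbf{z}^{(k)})$. For $\alpha>0$ and $\mathbf{w}\in\{\mathbf{x},\mathbf{y}\}$ set $$\mathbf{w}^{(k+1)}(\alpha)=\frac{\big[(1-\alpha(\mathbf{w}^{(k)})^\top\mathbf{p}_{\mathbf{w}}^{(k)})^2-\alpha^2\|\mathbf{p}_{\mathbf{w}}^{(k)}\|^2\big]\mathbf{w}^{(k)}+2\alpha\mathbf{p}_{\mathbf{w}}^{(k)}}{1+\alpha^2\|\mathbf{p}_{\mathbf{w}}^{(k)}\|^2-(\alpha(\mathbf{w}^{(k)})^\top\mathbf{p}_{\mathbf{w}}^{(k)})^2},$$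 and $\mathbf{z}^{(k+1)}(\alpha)=(\mathbf{x}^{(k+1)}(\alpha),\mathbf{y}^{(k+1)}(\alpha))$. The step size $\alpha^{(k)}$ is the first element of $1,\beta,\beta^2,\dots$ satisfying $f(\mathbf{z}^{(k+1)}(\alpha))\le f(\mathbf{z}^{(k)})+\eta\alpha(\mathbf{p}^{(k)})^\top\nabla f(\mathbf{z}^{(k)})$, and $\mathbf{z}^{(k+1)}=\mathbf{z}^{(k+1)}(\alpha^{(k)})$. The generated sequence is the infinite sequence obtained by ignoring the stopping rule. *)

(* Defs.v *)
From HB Require Import structures.
From mathcomp Require Import all_boot all_order all_algebra.
From mathcomp Require Import boolp classical_sets functions reals.
From mathcomp Require Import topology normedtype sequences derive.

Set Implicit Arguments.
Unset Strict Implicit.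
Unset Printing Implicit Defensive.

Import Order.TTheory GRing.Theory Num.Theory.
Import numFieldNormedType.Exports.

Local Open Scope classical_set_scope.
Local Open Scope ring_scope.

(* The library norm `|v| on matrices is the max norm; Euclidean quantities are
   therefore introduced separately.  The topology is the same. *)
Section Euclidean.
Variables (R : realType).

Definition dotv N (u v : 'cV[R]_N) : R := (u^T *m v) 0 0.

Definition l2norm N (v : 'cV[R]_N) : R := Num.sqrt (dotv v v).

Definition spectral_norm N (B : 'M[R]_N) : R :=
  sup [set l2norm (B *m v) | v in [set v : 'cV[R]_N | l2norm v = 1]].

Definition gradient N (g : 'cV[R]_N -> R) (z : 'cV[R]_N) : 'cV[R]_N :=
  \col_i 'D_(delta_mx i 0) g z.

Definition hessian N (g : 'cV[R]_N -> R) (z : 'cV[R]_N) : 'M[R]_N :=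
  \matrix_(i, j) 'D_(delta_mx j 0) (fun u => 'D_(delta_mx i 0) g u) z.

End Euclidean.

(* Entry a_{i1 j1 i2 j2} is A i1 j1 i2 j2. *)
Definition biquadratic_tensor (R : realType) (m n : nat) : Type :=
  'I_m -> 'I_n -> 'I_m -> 'I_n -> R.

(* A vector z of R^(m+n) is (x^T, y^T)^T with x = usubmx z and y = dsubmx z. *)
Section Problem.
Variables (R : realType) (m n : nat) (A : biquadratic_tensor R m n).

Definition biquad (x : 'cV[R]_m) (y : 'cV[R]_n) : R :=
  \sum_(i1 < m) \sum_(j1 < n) \sum_(i2 < m) \sum_(j2 < n)
    A i1 j1 i2 j2 * x i1 0 * y j1 0 * x i2 0 * y j2 0.

Definition M_eigenpair (lambda : R) (x : 'cV[R]_m) (y : 'cV[R]_n) : Prop :=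
  [/\ dotv x x = 1,
      dotv y y = 1,
      forall i : 'I_m,
        \sum_(i1 < m) \sum_(j1 < n) \sum_(j2 < n)
          A i1 j1 i j2 * x i1 0 * y j1 0 * y j2 0
        + \sum_(i2 < m) \sum_(j1 < n) \sum_(j2 < n)
            A i j1 i2 j2 * y j1 0 * x i2 0 * y j2 0
        = 2 * lambda * x i 0 &
      forall j : 'I_n,
        \sum_(i1 < m) \sum_(i2 < m) \sum_(j1 < n)
          A i1 j1 i2 j * x i1 0 * y j1 0 * x i2 0
        + \sum_(i1 < m) \sum_(i2 < m) \sum_(j2 < n)
            A i1 j i2 j2 * x i1 0 * x i2 0 * y j2 0
        = 2 * lambda * y j 0].

(* Only meaningful for nonzero blocks (elsewhere x / 0 = 0 applies); it is only
   evaluated or differentiated at points whose two blocks are unit vectors. *)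
Definition objective (z : 'cV[R]_(m + n)) : R :=
  let x := usubmx z in let y := dsubmx z in
  biquad x y / (dotv x x * dotv y y).

Definition constr_x (z : 'cV[R]_(m + n)) : R :=
  dotv (usubmx z) (usubmx z) - 1.

Definition constr_y (z : 'cV[R]_(m + n)) : R :=
  dotv (dsubmx z) (dsubmx z) - 1.

Definition feasible (z : 'cV[R]_(m + n)) : Prop :=
  constr_x z = 0 /\ constr_y z = 0.

Definition kkt_point (z : 'cV[R]_(m + n)) : Prop :=
  feasible z /\
  exists mu nu : R,
    gradient objective z =
      mu *: gradient constr_x z + nu *: gradient constr_y z.

End Problem.

(* Limited-memory BFGS approximation of the inverse Hessian of g along the
   iterates z 0, z 1, ...: starting from (gamma k) *: I, the inverse BFGS update
     H := V^T H V + rho s s^T,   V = I - rho y s^T,   rho = 1 / (y^T s),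
   is applied with the (at most) ell most recent pairs
     s = z (i+1) - z i,   y = grad g (z (i+1)) - grad g (z i),
   oldest first.  A pair with y^T s < kappa or y^T s = 0 leaves H unchanged
   (rho = 0, using 0^-1 = 0).  The memory ell, the initial scalings gamma and
   the curvature threshold kappa are not fixed by the algorithm; since y^T s
   stays bounded along the iterates, a sufficiently negative kappa amounts to
   the update without curvature test.  The sign of gamma is left free because
   the usual choice gamma k = s^T y / y^T y (latest pair) may be negative under
   a backtracking line search. *)
Section LBFGS.
Variables (R : realType) (N : nat) (g : 'cV[R]_N -> R).
Variables (ell : nat) (kappa : R) (gamma : nat -> R) (z : nat -> 'cV[R]_N).

Definition bfgs_update (H : 'M[R]_N) (i : nat) : 'M[R]_N :=
  let s := z i.+1 - z i in
  let y := gradient g (z i.+1) - gradient g (z i) in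
  let rho := if kappa <= dotv y s then (dotv y s)^-1 else 0 in
  let V := 1%:M - rho *: (y *m s^T) in
  V^T *m H *m V + rho *: (s *m s^T).

Definition lbfgs_matrix (k : nat) : 'M[R]_N :=
  foldl bfgs_update (gamma k)%:M (iota (k - ell) (minn ell k)).

End LBFGS.

Section Algorithm.
Variables (R : realType) (m n : nat) (A : biquadratic_tensor R m n).
Variables (eta beta CL CU : R).
Variables (ell : nat) (kappa : R) (gamma : nat -> R).

Definition block_descent N (p g : 'cV[R]_N) : bool :=
  (dotv p g <= - CL * l2norm g ^+ 2) && (l2norm p <= CU * l2norm g).

Definition search_direction (H : 'M[R]_(m + n)) (g : 'cV[R]_(m + n)) :
    'cV[R]_(m + n) :=
  let p := - (H *m g) in
  if block_descent (usubmx p) (usubmx g) && block_descent (dsubmx p) (dsubmx g)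
  then p else - g.

Definition sphere_curve N (w p : 'cV[R]_N) (alpha : R) : 'cV[R]_N :=
  (1 + alpha ^+ 2 * l2norm p ^+ 2 - (alpha * dotv w p) ^+ 2)^-1 *:
  (((1 - alpha * dotv w p) ^+ 2 - alpha ^+ 2 * l2norm p ^+ 2) *: w
   + (2 * alpha) *: p).

Definition trial_point (z p : 'cV[R]_(m + n)) (alpha : R) : 'cV[R]_(m + n) :=
  col_mx (sphere_curve (usubmx z) (usubmx p) alpha)
         (sphere_curve (dsubmx z) (dsubmx p) alpha).

Definition armijo (z p : 'cV[R]_(m + n)) (alpha : R) : bool :=
  objective A (trial_point z p alpha) <=
    objective A z + eta * alpha * dotv p (gradient (objective A) z).

Definition generated_by_rlbfgs (z : nat -> 'cV[R]_(m + n)) : Prop :=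
  [/\ l2norm (usubmx (z 0%N)) = 1,
      l2norm (dsubmx (z 0%N)) = 1 &
      forall k : nat,
        let H := lbfgs_matrix (objective A) ell kappa gamma z k in
        let p := search_direction H (gradient (objective A) (z k)) in
        exists j : nat,
          [/\ armijo (z k) p (beta ^+ j),
              forall i : nat, (i < j)%N -> ~~ armijo (z k) p (beta ^+ i) &
              z k.+1 = trial_point (z k) p (beta ^+ j)]].

End Algorithm.

(* Main.v *)
Require Import Defs.
From mathcomp Require Import all_boot all_order all_algebra.
From mathcomp Require Import boolp classical_sets functions reals.
From mathcomp Require Import topology normedtype sequences derive.
From mathcomp Require Import realfun ring lra.

Import Order.TTheory GRing.Theory Num.Theory.
Import numFieldNormedType.Exports.

Set Implicit Arguments.
Unset Strict Implicit.
Unset Printing Implicit Defensive.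

Local Open Scope classical_set_scope.
Local Open Scope ring_scope.

(** The objective is a quotient whose denominator equals one on the product of
    the two unit spheres, and every point produced by the algorithm lies there.

    On that product the objective coincides with the quartic form [biquad A],
    and its differential is [dobjective].  Two facts follow by pure algebra.
    The expansion of the 4-linear form behind [biquad A] gives a quadratic upper
    bound for the objective between points of the spheres
    ([objective_descent]), with a constant proportional to the sum of the
    absolute values of the entries of the tensor.  By homogeneity, each block of
    the gradient is orthogonal to the corresponding block of the point
    ([gradient_tangent_x], [gradient_tangent_y]), so that the slope along the
    update curve is exactly [2 * alpha * dotv p g / (1 + u)], where [1 + u] is
    the denominator of the curve, while the squared length of the step is
    [4 * u / (1 + u)] with [u <= alpha ^+ 2 * dotv p p].

    Hence every step size up to the threshold passes the Armijo test
    ([block_armijo], [armijo_small_step]), and backtracking stops no lower than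
    [beta] times the threshold.  The two block conditions on the direction hold
    whether or not the quasi-Newton direction is accepted, so the shape of the
    quasi-Newton matrix plays no role.  The sufficient decrease, summed against
    the lower bound of the objective, forces the gradient to zero
    ([decrease_cvg]); continuity of the gradient carries this to limit points,
    where the vanishing of the gradient is the system of M-eigenpair equations
    ([stationary_M_eigenpair]).

    The constant [M] is the sum of one, of 48 times the sum of the absolute
    values of the entries, and of bounds on the gradient and on the Hessian.
    The latter bounds come from the algebra of [regular] functions, which
    contains the objective, is stable under partial derivatives, and consists of
    functions bounded on the product of the spheres. *)

(** * Euclidean scalar product and norm *)

Section EuclideanTheory.
Variables (R : realType) (N : nat).
Implicit Types u v w : 'cV[R]_N.

Lemma dotvE u v : dotv u v = \sum_i u i 0 * v i 0.
Proof. by rewrite /dotv mxE; apply: eq_bigr => i _; rewrite mxE. Qed.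

Lemma dotvC u v : dotv u v = dotv v u.
Proof. by rewrite !dotvE; apply: eq_bigr => i _; rewrite mulrC. Qed.

Lemma dotv_linearr u a v w : dotv u (a *: v + w) = a * dotv u v + dotv u w.
Proof.
rewrite !dotvE mulr_sumr -big_split; apply: eq_bigr => i _.
by rewrite !mxE/=; ring.
Qed.

Lemma dotv_linearl u a v w : dotv (a *: v + w) u = a * dotv v u + dotv w u.
Proof. by rewrite dotvC dotv_linearr ![dotv u _]dotvC. Qed.

Lemma dotv0r u : dotv u 0 = 0.
Proof. by rewrite dotvE big1// => i _; rewrite mxE mulr0. Qed.

Lemma dotvDr u v w : dotv u (v + w) = dotv u v + dotv u w.
Proof. by rewrite -[v]scale1r dotv_linearr scale1r mul1r. Qed.

Lemma dotvZr a u v : dotv u (a *: v) = a * dotv u v.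
Proof. by rewrite -[a *: v]addr0 dotv_linearr dotv0r addr0. Qed.

Lemma dotvNr u v : dotv u (- v) = - dotv u v.
Proof. by rewrite -scaleN1r dotvZr mulN1r. Qed.

Lemma dotvDl u v w : dotv (v + w) u = dotv v u + dotv w u.
Proof. by rewrite dotvC dotvDr ![dotv u _]dotvC. Qed.

Lemma dotvZl a u v : dotv (a *: v) u = a * dotv v u.
Proof. by rewrite dotvC dotvZr [dotv u _]dotvC. Qed.

Lemma dotvNl u v : dotv (- v) u = - dotv v u.
Proof. by rewrite dotvC dotvNr [dotv u _]dotvC. Qed.

Lemma dotv_ge0 v : 0 <= dotv v v.
Proof. by rewrite dotvE sumr_ge0// => i _; rewrite -expr2 sqr_ge0. Qed.

Lemma l2norm_ge0 v : 0 <= l2norm v.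
Proof. exact: sqrtr_ge0. Qed.

Lemma sqr_l2norm v : l2norm v ^+ 2 = dotv v v.
Proof. by rewrite sqr_sqrtr ?dotv_ge0. Qed.

Lemma l2normN v : l2norm (- v) = l2norm v.
Proof. by rewrite /l2norm dotvNr dotvNl opprK. Qed.

Lemma l2norm_unit v : dotv v v = 1 -> l2norm v = 1.
Proof. by rewrite /l2norm => ->; rewrite sqrtr1. Qed.

Lemma unit_l2norm v : l2norm v = 1 -> dotv v v = 1.
Proof. by rewrite -sqr_l2norm => ->; rewrite expr1n. Qed.

Lemma sqr_coord_le v i : v i 0 ^+ 2 <= dotv v v.
Proof.
rewrite dotvE (bigD1 i)//= -expr2 lerDl sumr_ge0// => j _.
by rewrite -expr2 sqr_ge0.
Qed.

Lemma coord_le_l2norm v i : `|v i 0| <= l2norm v.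
Proof.
by rewrite -(ler_pXn2r (n := 2)) ?nnegrE ?l2norm_ge0// sqr_l2norm
  real_normK ?num_real// sqr_coord_le.
Qed.

Lemma sqr_dotv_unit_le w v : dotv w w = 1 -> dotv w v ^+ 2 <= dotv v v.
Proof.
move=> w1; rewrite -subr_ge0.
rewrite (_ : _ - _ = dotv (- dotv w v *: w + v) (- dotv w v *: w + v)).
  exact: dotv_ge0.
by rewrite dotv_linearl !dotv_linearr w1 (dotvC v w); ring.
Qed.

(** A linear form is represented by its values on the canonical basis. *)
Lemma dotv_linear_form (l : 'cV[R]_N -> R) :
  (forall a u v, l (a *: u + v) = a * l u + l v) ->
  forall v, dotv (\col_i l (delta_mx i 0)) v = l v.
Proof.
move=> lin v.
have l0 : l 0 = 0.
  by move: (lin (-1) 0 0); rewrite scaler0 addr0 => h; lra.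
have vE : v = \sum_i v i 0 *: delta_mx i 0.
  apply/colP => i; rewrite summxE (bigD1 i)//= !mxE !eqxx mulr1 big1 ?addr0//.
  by move=> j ji; rewrite !mxE eq_sym (negPf ji) mulr0.
rewrite [in RHS]vE dotvE; elim/big_rec2 : _ => [|i x y _ ->].
  by rewrite l0.
by rewrite lin !mxE mulrC.
Qed.

End EuclideanTheory.

Lemma l2norm_le_coord (R : realType) N (v : 'cV[R]_N) b :
  (forall i, `|v i 0| <= b) -> l2norm v <= N%:R * b.
Proof.
case: N v => [|p] v hb.
  by rewrite /l2norm dotvE big_ord0 sqrtr0 mul0r.
have b0 : 0 <= b by exact: le_trans (hb ord0).
rewrite -(ler_pXn2r (n := 2)) ?nnegrE ?l2norm_ge0 ?mulr_ge0//.
rewrite sqr_l2norm dotvE (@le_trans _ _ (\sum_(i < p.+1) b ^+ 2))//.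
  apply: ler_sum => i _; rewrite -expr2 -(real_normK (num_real _)).
  by rewrite ler_pXn2r ?nnegrE.
rewrite sumr_const card_ord -[leLHS]mulr_natl exprMn.
by apply: ler_wpM2r; rewrite ?sqr_ge0// expr2 ler_peMl// ler1n.
Qed.

Lemma dotv_split (R : realType) m n (u v : 'cV[R]_(m + n)) :
  dotv u v = dotv (usubmx u) (usubmx v) + dotv (dsubmx u) (dsubmx v).
Proof.
rewrite !dotvE big_split_ord/=; congr (_ + _);
by apply: eq_bigr => i _; rewrite !mxE.
Qed.

Lemma spectral_norm_le (R : realType) N (B : 'M[R]_N) b :
  (0 < N)%N -> (forall i j, `|B i j| <= b) ->
  spectral_norm B <= N%:R * (N%:R * b).
Proof.
case: N B => // p B _ hb; apply: ge_sup.
  exists (l2norm (B *m delta_mx ord0 0)) => /=; exists (delta_mx ord0 0) => //=.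
  apply: l2norm_unit; rewrite dotvE (bigD1 ord0)//= big1 => [|i /negPf i0].
    by rewrite mxE !eqxx mulr1 addr0.
  by rewrite mxE i0 mul0r.
move=> _ [v v1 <-]; apply: l2norm_le_coord => i; rewrite mxE.
apply: le_trans (ler_norm_sum _ _ _) _.
rewrite -[p.+1 in leRHS]card_ord mulr_natl -sumr_const; apply: ler_sum => j _.
rewrite normrM -[b]mulr1; apply: ler_pM => //.
by rewrite -v1 coord_le_l2norm.
Qed.

(** * The 4-linear form of a biquadratic tensor *)

Section MultilinearForm.
Variables (R : realType) (m n : nat) (A : biquadratic_tensor R m n).
Implicit Types a c x h : 'cV[R]_m.
Implicit Types b d y k : 'cV[R]_n.

(** The 4-linear form whose restriction to [a = c], [b = d] is [biquad A]. *)
Definition multiform a b c d : R :=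
  \sum_(p : 'I_m * 'I_n * 'I_m * 'I_n) A p.1.1.1 p.1.1.2 p.1.2 p.2 *
    (a p.1.1.1 0 * b p.1.1.2 0 * c p.1.2 0 * d p.2 0).

(** The sum of the absolute values of the entries, a bound for the form on unit
    vectors. *)
Definition entry_sum : R :=
  \sum_(p : 'I_m * 'I_n * 'I_m * 'I_n) `|A p.1.1.1 p.1.1.2 p.1.2 p.2|.

Lemma multiformE a b c d : multiform a b c d =
  \sum_(i1 < m) \sum_(j1 < n) \sum_(i2 < m) \sum_(j2 < n)
    A i1 j1 i2 j2 * (a i1 0 * b j1 0 * c i2 0 * d j2 0).
Proof. by rewrite !pair_bigA. Qed.

Lemma biquadE x y : biquad A x y = multiform x y x y.
Proof.
rewrite multiformE; do 4 apply: eq_bigr => ? _; ring.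
Qed.

Lemma multiform_linear1 t a a' b c d :
  multiform (t *: a + a') b c d = t * multiform a b c d + multiform a' b c d.
Proof.
rewrite mulr_sumr -big_split; apply: eq_bigr => p _; rewrite !mxE/=; ring.
Qed.

Lemma multiform_linear2 t a b b' c d :
  multiform a (t *: b + b') c d = t * multiform a b c d + multiform a b' c d.
Proof.
rewrite mulr_sumr -big_split; apply: eq_bigr => p _; rewrite !mxE/=; ring.
Qed.

Lemma multiform_linear3 t a b c c' d :
  multiform a b (t *: c + c') d = t * multiform a b c d + multiform a b c' d.
Proof.
rewrite mulr_sumr -big_split; apply: eq_bigr => p _; rewrite !mxE/=; ring.
Qed.

Lemma multiform_linear4 t a b c d d' :
  multiform a b c (t *: d + d') = t * multiform a b c d + multiform a b c d'.
Proof.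
rewrite mulr_sumr -big_split; apply: eq_bigr => p _; rewrite !mxE/=; ring.
Qed.

Definition multiform_linear := (multiform_linear1, multiform_linear2,
  multiform_linear3, multiform_linear4).

Lemma multiform0 :
  [/\ forall b c d, multiform 0 b c d = 0, forall a c d, multiform a 0 c d = 0,
      forall a b d, multiform a b 0 d = 0 & forall a b c, multiform a b c 0 = 0].
Proof. by split=> *; apply: big1 => p _; rewrite mxE; ring. Qed.

Lemma entry_sum_ge0 : 0 <= entry_sum.
Proof. by rewrite sumr_ge0. Qed.

Lemma multiform_le a b c d : `|multiform a b c d| <=
  entry_sum * (l2norm a * l2norm b * l2norm c * l2norm d).
Proof.
apply: le_trans (ler_norm_sum _ _ _) _; rewrite mulr_suml.
apply: ler_sum => p _; rewrite normrM; apply: ler_wpM2l => //; rewrite !normrM.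
by do 3 (apply: ler_pM; rewrite ?mulr_ge0 ?coord_le_l2norm//).
Qed.

(** The differential of [biquad A] at [(x, y)] in the direction [(h, k)]. *)
Definition dbiquad x y h k : R :=
  multiform h y x y + multiform x k x y + multiform x y h y + multiform x y x k.

(** Second-order Taylor estimate for [biquad A]: the remainder consists of the
    eleven terms of the expansion with at least two increments. *)
Lemma biquad_taylor x y h k : l2norm x = 1 -> l2norm y = 1 ->
  l2norm h <= 2 -> l2norm k <= 2 ->
  biquad A (h + x) (k + y) <= biquad A x y + dbiquad x y h k
    + 11 * entry_sum * (dotv h h + dotv k k).
Proof.
move=> x1 y1 h2 k2; rewrite !biquadE -[h]scale1r -[k]scale1r !multiform_linear.
rewrite !scale1r /dbiquad !mul1r -!sqr_l2norm.
have h0 := l2norm_ge0 h; have k0 := l2norm_ge0 k.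
have K0 := entry_sum_ge0.
have le a b c d : multiform a b c d <=
    entry_sum * (l2norm a * l2norm b * l2norm c * l2norm d).
  exact: le_trans (ler_norm _) (multiform_le _ _ _ _).
have hk : l2norm h * l2norm k <= (l2norm h ^+ 2 + l2norm k ^+ 2) / 2.
  by have := sqr_ge0 (l2norm h - l2norm k); nra.
have hhk : l2norm h ^+ 2 * l2norm k <= 2 * l2norm h ^+ 2.
  by rewrite mulrC; apply: ler_wpM2r; rewrite ?sqr_ge0.
have hkk : l2norm h * l2norm k ^+ 2 <= 2 * l2norm k ^+ 2.
  by apply: ler_wpM2r; rewrite ?sqr_ge0.
have hhkk : l2norm h ^+ 2 * l2norm k ^+ 2 <= 4 * l2norm k ^+ 2.
  by apply: ler_wpM2r; rewrite ?sqr_ge0//; nra.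
have := le h k h k; have := le h k h y; have := le h k x k; have := le h y h k.
have := le x k h k; have := le h k x y; have := le h y h y; have := le h y x k.
have := le x k h y; have := le x k x k; have := le x y h k.
rewrite !x1 !y1 !mulr1 !mul1r.
move: (l2norm h) (l2norm k) h0 k0 hk hhk hkk hhkk {h2 k2 le} => s t *.
have : entry_sum * (4 * (s * t) + s ^+ 2 + t ^+ 2 + 2 * (s ^+ 2 * t)
     + 2 * (s * t ^+ 2) + s ^+ 2 * t ^+ 2) <=
  entry_sum * (11 * (s ^+ 2 + t ^+ 2)) by apply: ler_wpM2l => //; nra.
lra.
Qed.

End MultilinearForm.

(** * Derivatives along lines and the gradient of the objective *)

Section DirectionalDerivatives.
Variables (R : realType) (V : normedModType R).

(** The directional derivative of a function that is a polynomial of degree at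
    most four along the line is the coefficient of degree one. *)
Lemma is_derive_quartic (g : V -> R) (z v : V) (c r0 r1 r2 : R) :
  (forall t, g (t *: v + z) =
     g z + t * c + t ^+ 2 * (r0 + t * r1 + t ^+ 2 * r2)) ->
  is_derive z v g c.
Proof.
move=> gE; pose r (t : R) := r0 + t * r1 + t * t * r2.
have r0c : {for 0, continuous r}.
  by apply: cvgD; [apply: cvgD; [exact: cvg_cst|]|];
    do ?[apply: cvgM | exact: cvg_id | exact: cvg_cst].
have cv : (fun t => t^-1 *: ((g \o shift z) (t *: v) - g z)) @ 0^' --> c.
  have cr : (fun t => c + t * r t) @ 0^' --> c.
    have : (fun t => c + t * r t) @ 0^' --> c + 0 * r 0.
      apply: cvgD; first exact: cvg_cst.
      apply: cvgM; first by apply: cvg_within_filter; exact: cvg_id.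
      exact: cvg_within_filter r0c.
    by rewrite mul0r addr0.
  apply: cvg_trans cr; apply: near_eq_cvg; near=> t.
  have t0 : t != 0 by near: t; exact: nbhs_dnbhs_neq.
  rewrite /= gE /GRing.scale/= /r; field; exact: t0.
by apply: DeriveDef; [apply: cvgP cv | exact: cvg_lim cv].
Unshelve. all: by end_near. Qed.

Lemma is_derive_inv (g : V -> R) (z v : V) (c : R) :
  g z != 0 -> is_derive z v g c ->
  is_derive z v (fun u => (g u)^-1) (- (c * (g z)^-1 * (g z)^-1)).
Proof.
move=> gz [dg dE]; apply: DeriveDef; first exact: derivableV.
by rewrite deriveV// dE /GRing.scale/= expr2 invfM; ring.
Qed.

End DirectionalDerivatives.

Lemma is_derive_coord (R : realType) N (z v : 'cV[R]_N) i :
  is_derive z v (fun u : 'cV[R]_N => u i 0) (v i 0).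
Proof.
apply: (@is_derive_quartic _ _ _ _ _ _ 0 0 0).
by move=> t; rewrite !mxE /=; ring.
Qed.

Section ObjectiveCalculus.
Variables (R : realType) (m n : nat) (A : biquadratic_tensor R m n).
Implicit Types z v : 'cV[R]_(m + n).

(** The denominator of the objective. *)
Definition denom z : R :=
  dotv (usubmx z) (usubmx z) * dotv (dsubmx z) (dsubmx z).

(** The product of the two unit spheres. *)
Definition on_spheres z : Prop :=
  dotv (usubmx z) (usubmx z) = 1 /\ dotv (dsubmx z) (dsubmx z) = 1.

Lemma denom_on_spheres z : on_spheres z -> denom z = 1.
Proof. by rewrite /denom => -[-> ->]; rewrite mulr1. Qed.

(** The differential of the denominator at [z] in the direction [v]. *)
Definition ddenom z v : R :=
  2 * dotv (usubmx z) (usubmx v) * dotv (dsubmx z) (dsubmx z) +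
  2 * dotv (usubmx z) (usubmx z) * dotv (dsubmx z) (dsubmx v).

Lemma usubmx_linear (t : R) v z :
  usubmx (t *: v + z) = t *: usubmx v + usubmx z.
Proof. by apply/colP => i; rewrite !mxE. Qed.

Lemma dsubmx_linear (t : R) v z :
  dsubmx (t *: v + z) = t *: dsubmx v + dsubmx z.
Proof. by apply/colP => i; rewrite !mxE. Qed.

Lemma is_derive_denom z v : is_derive z v denom (ddenom z v).
Proof.
pose x := usubmx z; pose y := dsubmx z; pose h := usubmx v; pose k := dsubmx v.
apply: (@is_derive_quartic _ _ _ _ _ _
  (dotv h h * dotv y y + 4 * dotv x h * dotv y k + dotv x x * dotv k k)
  (2 * dotv h h * dotv y k + 2 * dotv x h * dotv k k)
  (dotv h h * dotv k k)) => t.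
 rewrite /denom /ddenom usubmx_linear dsubmx_linear.
rewrite !(dotv_linearl, dotv_linearr) -/x -/y -/h -/k.
by rewrite (dotvC h x) (dotvC k y); ring.
Qed.

Lemma is_derive_biquad z v :
  is_derive z v (fun u => biquad A (usubmx u) (dsubmx u))
    (dbiquad A (usubmx z) (dsubmx z) (usubmx v) (dsubmx v)).
Proof.
pose x := usubmx z; pose y := dsubmx z; pose h := usubmx v; pose k := dsubmx v.
pose T := multiform A.
apply: (@is_derive_quartic _ _ _ _ _ _
  (T h k x y + T h y h y + T h y x k + T x k h y + T x k x k + T x y h k)
  (T h k h y + T h k x k + T h y h k + T x k h k)
  (T h k h k)) => t.
rewrite !biquadE usubmx_linear dsubmx_linear !multiform_linear.
by rewrite /dbiquad -/T -/x -/y -/h -/k; ring.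
Qed.

(** The differential of the objective at the points of the product of the
    spheres, in the direction [v]. *)
Definition dobjective z v : R :=
  dbiquad A (usubmx z) (dsubmx z) (usubmx v) (dsubmx v)
  - 2 * biquad A (usubmx z) (dsubmx z)
    * (dotv (usubmx z) (usubmx v) + dotv (dsubmx z) (dsubmx v)).

Lemma objective_on_spheres z : on_spheres z ->
  objective A z = biquad A (usubmx z) (dsubmx z).
Proof. by case=> x1 y1; rewrite /objective x1 y1 mulr1 invr1 mulr1. Qed.

Lemma is_derive_objective z v : on_spheres z ->
  is_derive z v (objective A) (dobjective z v).
Proof.
move=> zS; have q1 := denom_on_spheres zS; case: (zS) => x1 y1.
have q0 : denom z != 0 by rewrite q1 oner_neq0.
have -> : objective A = (fun u => biquad A (usubmx u) (dsubmx u)) *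
    (fun u => (denom u)^-1) by [].
apply: is_derive_eq.
  exact: is_deriveM (is_derive_biquad z v)
    (is_derive_inv q0 (is_derive_denom z v)).
rewrite /GRing.scale/= q1 /ddenom x1 y1 invr1 /dobjective.
by ring.
Qed.

Lemma dobjective_linear z a u v :
  dobjective z (a *: u + v) = a * dobjective z u + dobjective z v.
Proof.
rewrite /dobjective /dbiquad usubmx_linear dsubmx_linear.
by rewrite !multiform_linear !dotv_linearr; ring.
Qed.

Lemma gradientE z i : on_spheres z ->
  gradient (objective A) z i 0 = dobjective z (delta_mx i 0).
Proof.
by move=> zS; rewrite mxE; have [_ ->] := is_derive_objective (delta_mx i 0) zS.
Qed.

Lemma dotv_gradient z v : on_spheres z ->
  dotv (gradient (objective A) z) v = dobjective z v.
Proof.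
move=> zS; rewrite -(dotv_linear_form (@dobjective_linear z)); congr dotv.
by apply/colP => i; rewrite gradientE// mxE.
Qed.

(** By homogeneity, each block of the gradient is tangent to its sphere. *)
Lemma gradient_tangent_x z : on_spheres z ->
  dotv (usubmx z) (usubmx (gradient (objective A) z)) = 0.
Proof.
move=> zS; case: (zS) => x1 y1; rewrite dotvC.
have := dotv_gradient (col_mx (usubmx z) 0) zS; rewrite dotv_split.
rewrite col_mxKu col_mxKd dotv0r addr0 => ->.
rewrite /dobjective /dbiquad col_mxKu col_mxKd dotv0r x1 biquadE.
have [_ z2 _ z4] := multiform0 A.
by rewrite z2 z4; ring.
Qed.

Lemma gradient_tangent_y z : on_spheres z ->
  dotv (dsubmx z) (dsubmx (gradient (objective A) z)) = 0.
Proof.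
move=> zS; case: (zS) => x1 y1; rewrite dotvC.
have := dotv_gradient (col_mx 0 (dsubmx z)) zS; rewrite dotv_split.
rewrite col_mxKu col_mxKd dotv0r add0r => ->.
rewrite /dobjective /dbiquad col_mxKu col_mxKd dotv0r y1 biquadE.
have [z1 _ z3 _] := multiform0 A.
by rewrite z1 z3; ring.
Qed.

End ObjectiveCalculus.

(** * Bounds and continuity of first and second derivatives *)

Section RegularFunctions.
Variables (R : realType) (m n : nat).
Implicit Types (z : 'cV[R]_(m + n)) (f g : 'cV[R]_(m + n) -> R).

(** The algebra generated by the constants, the coordinates and the inverse of
    the denominator of the objective.  It contains the objective and
    its members are bounded on the product of the spheres.  It is stable under
    partial derivatives wherever the denominator does not vanish, in particular
    near the product of the spheres. *)
Inductive regular : ('cV[R]_(m + n) -> R) -> Prop :=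
| regular_cst c : regular (fun=> c)
| regular_coord i : regular (fun z => z i 0)
| regular_add f g : regular f -> regular g -> regular (fun z => f z + g z)
| regular_mul f g : regular f -> regular g -> regular (fun z => f z * g z)
| regular_inv : regular (fun z => (denom z)^-1).

Lemma eq_regular f g : (forall z, f z = g z) -> regular f -> regular g.
Proof. by move=> /funext ->. Qed.

Lemma regular_sum (I : finType) (F : I -> 'cV[R]_(m + n) -> R) :
  (forall i, regular (F i)) -> regular (fun z => \sum_i F i z).
Proof.
move=> rF; elim: (index_enum I) => [|i s ih].
  by apply: eq_regular (regular_cst 0) => z; rewrite big_nil.
by apply: eq_regular (regular_add (rF i) ih) => z; rewrite big_cons.
Qed.

Lemma regular_usubmx i : regular (fun z => usubmx z i 0).
Proof. by apply: eq_regular (regular_coord (lshift n i)) => z; rewrite mxE. Qed.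

Lemma regular_dsubmx i : regular (fun z => dsubmx z i 0).
Proof. by apply: eq_regular (regular_coord (rshift m i)) => z; rewrite mxE. Qed.

Lemma regular_dotv N (F G : 'cV[R]_(m + n) -> 'cV[R]_N) :
  (forall i, regular (fun z => F z i 0)) ->
  (forall i, regular (fun z => G z i 0)) ->
  regular (fun z => dotv (F z) (G z)).
Proof.
move=> rF rG.
apply: (@eq_regular (fun z => \sum_i F z i 0 * G z i 0)) => [z|].
  by rewrite dotvE.
by apply: regular_sum => i; exact: regular_mul.
Qed.

Lemma regular_ddenom v : regular (fun z => ddenom z v).
Proof.
by do ?[apply: regular_add | apply: regular_mul | apply: regular_dotv];
  move=> *; solve [exact: regular_cst | exact: regular_usubmx
                 | exact: regular_dsubmx].
Qed.

Lemma regular_objective (A : biquadratic_tensor R m n) : regular (objective A).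
Proof.
apply: regular_mul; last exact: regular_inv.
do 4 apply: regular_sum => ?.
by do ?[apply: regular_mul]; solve [exact: regular_cst | exact: regular_usubmx
                 | exact: regular_dsubmx].
Qed.

Lemma regular_derive f (i : 'I_(m + n)) : regular f ->
  exists g, regular g /\
    forall z, denom z != 0 -> is_derive z (delta_mx i 0) f (g z).
Proof.
elim=> {f} [c|j|f1 f2 r1 [g1 [rg1 d1]] r2 [g2 [rg2 d2]]
  |f1 f2 r1 [g1 [rg1 d1]] r2 [g2 [rg2 d2]]|].
- exists (fun=> 0); split; first exact: regular_cst.
  by move=> z _; exact: is_derive_cst.
- exists (fun=> (delta_mx i 0 : 'cV[R]_(m + n)) j 0).
  split; first exact: regular_cst.
  by move=> z _; exact: is_derive_coord.
- exists (fun z => g1 z + g2 z); split; first exact: regular_add.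
  by move=> z z0; exact: is_deriveD (d1 z z0) (d2 z z0).
- exists (fun z => f1 z * g2 z + f2 z * g1 z); split.
    by apply: regular_add; exact: regular_mul.
  by move=> z z0; exact: is_deriveM (d1 z z0) (d2 z z0).
- exists (fun z =>
    -1 * (ddenom z (delta_mx i 0) * (denom z)^-1 * (denom z)^-1)); split.
    do ?[apply: regular_mul | exact: regular_inv | exact: regular_cst].
    exact: regular_ddenom.
  move=> z z0; rewrite mulN1r.
  exact: is_derive_inv z0 (is_derive_denom _ _).
Qed.

Lemma regular_bounded f : regular f ->
  exists K, forall z, on_spheres z -> `|f z| <= K.
Proof.
elim=> {f} [c|j|f1 f2 r1 [K1 h1] r2 [K2 h2]|f1 f2 r1 [K1 h1] r2 [K2 h2]|].
- by exists `|c|.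
- exists 2 => z [x1 y1]; have := sqr_coord_le z j.
  rewrite dotv_split x1 y1 -(real_normK (num_real _)).
  by have := normr_ge0 (z j 0); nra.
- exists (K1 + K2) => z zS; apply: le_trans (ler_normD _ _) _.
  by rewrite lerD ?h1 ?h2.
- by exists (K1 * K2) => z zS; rewrite normrM; apply: ler_pM => //; auto.
- by exists 1 => z zS; rewrite denom_on_spheres// invr1 normr1.
Qed.

Lemma continuous_sqr_norm N (F : 'cV[R]_(m + n) -> 'cV[R]_N) :
  (forall i, continuous (fun z => F z i 0)) ->
  continuous (fun z => dotv (F z) (F z)).
Proof.
move=> cF z.
rewrite (_ : (fun z => _) = \sum_i (fun z => F z i 0 * F z i 0)); last first.
  by apply/funext => u; rewrite fct_sumE dotvE.
elim/big_ind : _ => [|f g cf cg|i _].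
- exact: cst_continuous.
- exact: cvgD cf cg.
- exact: cvgM (cF i z) (cF i z).
Qed.

Lemma continuous_sqr_norm_x : continuous (fun z => dotv (usubmx z) (usubmx z)).
Proof.
apply: continuous_sqr_norm => i.
rewrite (_ : (fun z => _) = fun z => z (lshift n i) 0); last first.
  by apply/funext => z; rewrite mxE.
exact: coord_continuous.
Qed.

Lemma continuous_sqr_norm_y : continuous (fun z => dotv (dsubmx z) (dsubmx z)).
Proof.
apply: continuous_sqr_norm => i.
rewrite (_ : (fun z => _) = fun z => z (rshift m i) 0); last first.
  by apply/funext => z; rewrite mxE.
exact: coord_continuous.
Qed.

Lemma continuous_denom : continuous (@denom R m n).
Proof.
move=> z.
exact: cvgM (@continuous_sqr_norm_x z) (@continuous_sqr_norm_y z).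
Qed.

Lemma regular_continuous f z : regular f -> denom z != 0 ->
  {for z, continuous f}.
Proof.
move=> rf z0; elim: rf => {f} [c|j|f g _ cf _ cg|f g _ cf _ cg|].
- exact: cst_continuous.
- exact: coord_continuous.
- exact: cvgD cf cg.
- exact: cvgM cf cg.
- exact: cvgV z0 (@continuous_denom z).
Qed.

Lemma denom_near z : denom z != 0 -> \forall u \near z, denom u != 0.
Proof. by move=> z0; exact: cvgr_neq0 (@continuous_denom z) z0. Qed.

Lemma regular_family_bounded (I : finType) (F : I -> 'cV[R]_(m + n) -> R) :
  (forall i, regular (F i)) ->
  exists2 K, 0 <= K & forall i z, on_spheres z -> `|F i z| <= K.
Proof.
move=> rF; have /choice[K hK] := fun i => regular_bounded (rF i).
exists (\sum_i `|K i|) => [|i z zS]; first exact: sumr_ge0.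
apply: le_trans (hK i z zS) _; apply: le_trans (ler_norm _) _.
by rewrite (bigD1 i)//= lerDl sumr_ge0.
Qed.

Section Derivatives.
Variable f : 'cV[R]_(m + n) -> R.
Hypothesis rf : regular f.

Lemma regular_gradient :
  exists g : 'I_(m + n) -> 'cV[R]_(m + n) -> R, (forall i, regular (g i)) /\
    forall i z, denom z != 0 -> gradient f z i 0 = g i z.
Proof.
have [g hg] := choice (fun i => regular_derive i rf).
exists g; split=> [i|i z z0]; first by case: (hg i).
by rewrite mxE; have [_ /(_ z z0)[_ ->]] := hg i.
Qed.

Lemma regular_hessian :
  exists h : 'I_(m + n) * 'I_(m + n) -> 'cV[R]_(m + n) -> R,
    (forall p, regular (h p)) /\
    forall i j z, denom z != 0 -> hessian f z i j = h (i, j) z.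
Proof.
have [g [rg gE]] := regular_gradient.
have [h hh] := choice (fun p => regular_derive p.2 (rg p.1)).
exists h; split=> [p|i j z z0]; first by case: (hh p).
rewrite mxE; have [_ /(_ z z0)[_ <-]] := hh (i, j).
apply: near_eq_derive; near=> u; rewrite -gE ?mxE//.
by near: u; exact: denom_near.
Unshelve. all: by end_near. Qed.

Lemma gradient_bounded :
  exists2 K, 0 <= K & forall z, on_spheres z -> l2norm (gradient f z) <= K.
Proof.
have [g [rg gE]] := regular_gradient.
have [K K0 hK] := regular_family_bounded rg.
exists ((m + n)%:R * K) => [|z zS]; first by rewrite mulr_ge0.
apply: l2norm_le_coord => i; rewrite gE ?hK//.
by rewrite denom_on_spheres ?oner_neq0.
Qed.

Lemma hessian_bounded : (0 < m + n)%N ->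
  exists2 K, 0 <= K & forall z, on_spheres z ->
    spectral_norm (hessian f z) <= K.
Proof.
move=> mn; have [h [rh hE]] := regular_hessian.
have [K K0 hK] := regular_family_bounded rh.
exists ((m + n)%:R * ((m + n)%:R * K)) => [|z zS]; first by rewrite !mulr_ge0.
apply: spectral_norm_le => // i j; rewrite hE ?hK//.
by rewrite denom_on_spheres ?oner_neq0.
Qed.

Lemma continuous_gradient i z : on_spheres z ->
  {for z, continuous (fun u => gradient f u i 0)}.
Proof.
move=> zS; have z0 : denom z != 0 by rewrite denom_on_spheres ?oner_neq0.
have [g [rg gE]] := regular_gradient.
rewrite /prop_for /continuous_at gE//.
have gE_near : \forall u \near z, g i u = gradient f u i 0.
  by near=> u; rewrite gE//; near: u; exact: denom_near.
exact: cvg_trans (near_eq_cvg gE_near) (regular_continuous (rg i) z0).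
Unshelve. all: by end_near. Qed.

End Derivatives.

End RegularFunctions.

(** * The update curve on a sphere *)

Section SphereCurve.
Variables (R : realType) (N : nat) (w p : 'cV[R]_N) (alpha : R).
Hypothesis w1 : dotv w w = 1.

(** The excess over [1] of the denominator of the curve. *)
Definition curve_excess : R := alpha ^+ 2 * (dotv p p - dotv w p ^+ 2).

Lemma curve_excess_ge0 : 0 <= curve_excess.
Proof. by rewrite mulr_ge0 ?sqr_ge0// subr_ge0 sqr_dotv_unit_le. Qed.

Lemma curve_excess_le : curve_excess <= alpha ^+ 2 * dotv p p.
Proof. by apply: ler_wpM2l; rewrite ?sqr_ge0// gerBl sqr_ge0. Qed.

Let D_neq0 : 1 + curve_excess != 0.
Proof. by rewrite gt_eqF// ltr_pwDl// curve_excess_ge0. Qed.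

Let curveE : sphere_curve w p alpha = (1 + curve_excess)^-1 *:
  (((1 - alpha * dotv w p) ^+ 2 - alpha ^+ 2 * dotv p p) *: w
   + (2 * alpha) *: p).
Proof.
rewrite /sphere_curve sqr_l2norm /curve_excess; congr (_^-1 *: _); ring.
Qed.

Lemma sphere_curve_unit :
  dotv (sphere_curve w p alpha) (sphere_curve w p alpha) = 1.
Proof.
move: D_neq0; rewrite curveE !(dotvZl, dotvZr, dotvDl, dotvDr).
rewrite w1 (dotvC p w) /curve_excess.
by move=> D0; field.
Qed.

Lemma sqr_norm_curve_step :
  dotv (sphere_curve w p alpha - w) (sphere_curve w p alpha - w) =
    4 * curve_excess / (1 + curve_excess).
Proof.
have c1 := sphere_curve_unit.
have cw : dotv w (sphere_curve w p alpha)
    = (1 - curve_excess) / (1 + curve_excess).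
  move: D_neq0; rewrite curveE dotvZr dotv_linearr dotvZr w1 /curve_excess.
  by move=> D0; field.
rewrite !(dotvDl, dotvDr, dotvNl, dotvNr) c1 w1 (dotvC _ w) cw.
by field.
Qed.

Lemma dotv_curve_step g : dotv w g = 0 ->
  dotv g (sphere_curve w p alpha - w) =
    2 * alpha * dotv p g / (1 + curve_excess).
Proof.
rewrite dotvC => gw; rewrite dotvDr dotvNr gw subr0 curveE dotvZr dotv_linearr.
by rewrite gw dotvZr (dotvC g p); ring.
Qed.

Lemma norm_curve_step_le2 : l2norm (sphere_curve w p alpha - w) <= 2.
Proof.
have u0 := curve_excess_ge0.
rewrite -(ler_pXn2r (n := 2)) ?nnegrE ?l2norm_ge0// sqr_l2norm.
rewrite sqr_norm_curve_step ler_pdivrMr ?ltr_pwDl//; lra.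
Qed.

End SphereCurve.

(** * Descent and the Armijo inequality *)

Section SufficientDecrease.
Variables (R : realType) (m n : nat) (A : biquadratic_tensor R m n).
Implicit Types z p : 'cV[R]_(m + n).

Lemma objective_le_entry_sum z : on_spheres z ->
  `|objective A z| <= entry_sum A.
Proof.
move=> zS; rewrite objective_on_spheres// biquadE; case: zS => x1 y1.
apply: le_trans (multiform_le _ _ _ _ _) _.
by rewrite !l2norm_unit// !mulr1.
Qed.

(** Descent lemma between points of the product of the spheres.  A chord [d] of
    the unit sphere at [w] satisfies [2 * dotv w d = - dotv d d], so that the
    normal part of the gradient only contributes to the quadratic term. *)
Lemma objective_descent z z' : on_spheres z -> on_spheres z' ->
  l2norm (usubmx z' - usubmx z) <= 2 -> l2norm (dsubmx z' - dsubmx z) <= 2 ->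
  objective A z' <= objective A z + dotv (gradient (objective A) z) (z' - z)
    + 12 * entry_sum A * (dotv (usubmx z' - usubmx z) (usubmx z' - usubmx z)
                        + dotv (dsubmx z' - dsubmx z) (dsubmx z' - dsubmx z)).
Proof.
move=> zS z'S h2 k2; rewrite dotv_gradient//.
have fK := objective_le_entry_sum zS.
have -> : dobjective A z (z' - z) =
    dbiquad A (usubmx z) (dsubmx z)
      (usubmx z' - usubmx z) (dsubmx z' - dsubmx z)
  - 2 * objective A z * (dotv (usubmx z) (usubmx z' - usubmx z)
                       + dotv (dsubmx z) (dsubmx z' - dsubmx z)).
  by rewrite /dobjective !linearB/= objective_on_spheres.
case: (zS) (z'S) => x1 y1 [x'1 y'1].
have := biquad_taylor A (l2norm_unit x1) (l2norm_unit y1) h2 k2.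
rewrite !subrK -!objective_on_spheres//.
have chord N (w w' : 'cV[R]_N) : dotv w w = 1 -> dotv w' w' = 1 ->
    dotv w (w' - w) = - (dotv (w' - w) (w' - w) / 2).
  move=> w1 w'1; rewrite !(dotvDl, dotvDr, dotvNl, dotvNr) w1 w'1 (dotvC w' w).
  by field.
rewrite !chord//.
have := dotv_ge0 (usubmx z' - usubmx z).
have := dotv_ge0 (dsubmx z' - dsubmx z).
move: (dotv (usubmx z' - _) _) (dotv (dsubmx z' - _) _) => s t t0 s0 le.
have := ler_norml (objective A z) (entry_sum A); rewrite fK => /esym/andP[fl _].
nra.
Qed.

(** The contribution of one block to the Armijo inequality: [b] is the slope of
    the direction, [P] its squared norm, [G] the norm of the gradient and [u]
    the excess of the curve denominator.  Since [alpha * M * CU ^+ 2] is at most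
    [(2 - eta) * CL / (2 + eta)], the excess is at most
    [((2 - eta) / (2 + eta)) ^+ 2] and the quadratic term is dominated. *)
Lemma block_armijo eta CL CU M alpha b P G u :
  0 < eta -> eta < 2 -> 0 < CL -> CL <= 1 -> 1 <= CU ->
  1 <= M -> 48 * entry_sum A <= M ->
  0 < alpha -> alpha <= (2 - eta) * CL / ((2 + eta) * M * CU ^+ 2) ->
  0 <= G -> G <= M -> b <= - CL * G ^+ 2 -> P <= CU ^+ 2 * G ^+ 2 ->
  0 <= u -> u <= alpha ^+ 2 * P ->
  2 * alpha * b / (1 + u) + 12 * entry_sum A * (4 * u / (1 + u)) <=
    eta * alpha * b.
Proof.
move=> eta0 eta2 CL0 CL1 CU1 M1 MK a0 aM G0 GM bG PG u0 uP.
have D0 : 0 < 1 + u by lra.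
have K0 := entry_sum_ge0 A.
have C1 : 1 <= CU ^+ 2 by exact: exprn_ege1.
have C0 : 0 < CU ^+ 2 by lra.
pose X := alpha * M * CU ^+ 2.
have X0 : 0 < X by rewrite /X !mulr_gt0//; lra.
have XE : X * (2 + eta) <= (2 - eta) * CL.
  move: aM; rewrite ler_pdivlMr ?mulr_gt0 ?exprn_gt0//; try lra.
  by rewrite /X; congr (_ <= _); ring.
have KP : 48 * entry_sum A * u <= alpha * X * G ^+ 2.
  have KS0 : 0 <= 48 * entry_sum A by rewrite mulr_ge0.
  have h1 := ler_wpM2l KS0 uP.
  have h2 := ler_wpM2l (sqr_ge0 alpha) PG.
  have h3 := ler_wpM2l KS0 h2.
  have Q0 : 0 <= alpha ^+ 2 * (CU ^+ 2 * G ^+ 2).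
    by apply: mulr_ge0; [|apply: mulr_ge0]; exact: sqr_ge0.
  have h4 := ler_wpM2r Q0 MK.
  apply: le_trans h1 (le_trans h3 (le_trans h4 _)).
  by rewrite /X le_eqVlt; apply/orP; left; apply/eqP; ring.
have uX : u <= X ^+ 2.
  apply: le_trans uP _.
  have -> : X ^+ 2 = alpha ^+ 2 * (CU ^+ 2 * (CU ^+ 2 * M ^+ 2)).
    by rewrite /X; ring.
  apply: ler_wpM2l; first exact: sqr_ge0.
  apply: le_trans PG _; apply: ler_wpM2l; first exact: ltW.
  have GM2 : G ^+ 2 <= M ^+ 2 by rewrite ler_pXn2r// nnegrE; lra.
  by apply: (le_trans GM2); rewrite ler_peMl// sqr_ge0.
suff key : X * G ^+ 2 <= - b * (2 - eta - eta * u).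
  have : alpha * (X * G ^+ 2) <= alpha * (- b * (2 - eta - eta * u)).
    by rewrite ler_pM2l.
  have -> : 2 * alpha * b / (1 + u) + 12 * entry_sum A * (4 * u / (1 + u)) =
      (2 * alpha * b + 48 * entry_sum A * u) / (1 + u).
    by field; rewrite gt_eqF.
  by rewrite ler_pdivrMr//; lra.
(* [X <= (2 - eta) / 2] and [eta * (2 - eta) <= 1] leave three quarters of
   [2 - eta] once [eta * u] is subtracted *)
have X1 : X <= (2 - eta) / 2 by nra.
have X2 : X ^+ 2 * 4 <= (2 - eta) ^+ 2 by nra.
have margin : (2 - eta) * (3 / 4) <= 2 - eta - eta * u.
  have h1 : u * 4 <= (2 - eta) ^+ 2 by lra.
  have h2 := ler_wpM2l (ltW eta0) h1.
  have h3 : eta * (2 - eta) <= 1 by have := sqr_ge0 (eta - 1); lra.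
  have h4 : 0 <= 2 - eta by lra.
  by have := ler_wpM2l h4 h3; lra.
have XC : X <= CL * (2 - eta) / 2 by nra.
have G2 := sqr_ge0 G.
have h1 : CL * G ^+ 2 * (2 - eta - eta * u) <= - b * (2 - eta - eta * u).
  by apply: ler_wpM2r; lra.
apply: le_trans h1.
have h2 : X * G ^+ 2 <= CL * (2 - eta) / 2 * G ^+ 2 by apply: ler_wpM2r.
apply: le_trans h2 _.
have h3 : 0 <= CL * G ^+ 2 by rewrite mulr_ge0// ltW.
have : CL * G ^+ 2 * ((2 - eta) / 2) <= CL * G ^+ 2 * (2 - eta - eta * u).
  by apply: ler_wpM2l => //; lra.
by lra.
Qed.

End SufficientDecrease.

(** * Iterates and limits *)

Section Iteration.
Variables (R : realType) (m n : nat) (A : biquadratic_tensor R m n).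
Implicit Types z p : 'cV[R]_(m + n).

Lemma trial_point_on_spheres z p alpha : on_spheres z ->
  on_spheres (trial_point z p alpha).
Proof.
by case=> x1 y1; rewrite /on_spheres /trial_point col_mxKu col_mxKd;
  split; apply: sphere_curve_unit.
Qed.

Lemma block_descentP CL CU N (p g : 'cV[R]_N) : 0 <= CU ->
  block_descent CL CU p g ->
  dotv p g <= - CL * l2norm g ^+ 2 /\ dotv p p <= CU ^+ 2 * l2norm g ^+ 2.
Proof.
move=> C0 /andP[h1 h2]; split=> //.
by rewrite -sqr_l2norm -exprMn ler_pXn2r// nnegrE ?mulr_ge0 ?l2norm_ge0.
Qed.

(** Both the quasi-Newton direction, when accepted, and the steepest descent
    direction satisfy the two block conditions. *)
Lemma search_direction_descent CL CU (H : 'M[R]_(m + n)) (g : 'cV[R]_(m + n)) :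
  CL <= 1 -> 1 <= CU ->
  let p := search_direction CL CU H g in
  block_descent CL CU (usubmx p) (usubmx g) /\
  block_descent CL CU (dsubmx p) (dsubmx g).
Proof.
move=> CL1 CU1; rewrite /search_direction; case: ifP => [/andP//|_].
have neg N (v : 'cV[R]_N) : block_descent CL CU (- v) v.
  rewrite /block_descent dotvNl l2normN sqr_l2norm mulNr lerN2.
  by rewrite ler_piMl ?dotv_ge0//= ler_peMl ?l2norm_ge0.
have -> : usubmx (- g) = - usubmx g by apply/colP => i; rewrite !mxE.
have -> : dsubmx (- g) = - dsubmx g by apply/colP => i; rewrite !mxE.
by [].
Qed.

Lemma l2norm_usubmx_le z : l2norm (usubmx z) <= l2norm z.
Proof. by rewrite ler_sqrt ?dotv_ge0// dotv_split lerDl dotv_ge0. Qed.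

Lemma l2norm_dsubmx_le z : l2norm (dsubmx z) <= l2norm z.
Proof. by rewrite ler_sqrt ?dotv_ge0// dotv_split lerDr dotv_ge0. Qed.

Lemma armijo_small_step eta CL CU M z p alpha :
  0 < eta -> eta < 2 -> 0 < CL -> CL <= 1 -> 1 <= CU ->
  1 <= M -> 48 * entry_sum A <= M ->
  on_spheres z -> l2norm (gradient (objective A) z) <= M ->
  block_descent CL CU (usubmx p) (usubmx (gradient (objective A) z)) ->
  block_descent CL CU (dsubmx p) (dsubmx (gradient (objective A) z)) ->
  0 < alpha -> alpha <= (2 - eta) * CL / ((2 + eta) * M * CU ^+ 2) ->
  armijo A eta z p alpha.
Proof.
move=> eta0 eta2 CL0 CL1 CU1 M1 MK zS gM px py a0 aM.
have CU0 : 0 <= CU by lra.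
have [slx Px] := block_descentP CU0 px; have [sly Py] := block_descentP CU0 py.
have := gradient_tangent_x A zS; have := gradient_tangent_y A zS.
set g := gradient (objective A) z in gM px py slx Px sly Py *.
move=> ty tx; case: (zS) => x1 y1.
have tS := trial_point_on_spheres p alpha zS.
have stepx : usubmx (trial_point z p alpha) - usubmx z =
    sphere_curve (usubmx z) (usubmx p) alpha - usubmx z by rewrite col_mxKu.
have stepy : dsubmx (trial_point z p alpha) - dsubmx z =
    sphere_curve (dsubmx z) (dsubmx p) alpha - dsubmx z by rewrite col_mxKd.
have := objective_descent A zS tS; rewrite stepx stepy.
move=> /(_ (norm_curve_step_le2 _ _ x1) (norm_curve_step_le2 _ _ y1)).
rewrite -/g !sqr_norm_curve_step// dotv_split !linearB/= stepx stepy.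
rewrite !dotv_curve_step// => desc; rewrite /armijo -/g dotv_split.
have block := block_armijo eta0 eta2 CL0 CL1 CU1 M1 MK a0 aM.
have := block _ _ _ _ (l2norm_ge0 _) (le_trans (l2norm_usubmx_le _) gM) slx Px
  (curve_excess_ge0 (usubmx p) alpha x1) (curve_excess_le _ _ _).
have := block _ _ _ _ (l2norm_ge0 _) (le_trans (l2norm_dsubmx_le _) gM) sly Py
  (curve_excess_ge0 (dsubmx p) alpha y1) (curve_excess_le _ _ _).
by lra.
Qed.

End Iteration.

Lemma cluster_continuous_limit (R : realType) (T : topologicalType)
    (z : nat -> T) (h : T -> R) zs l :
  cluster (z @ \oo) zs -> {for zs, continuous h} ->
  (fun k => h (z k)) @ \oo --> l -> h zs = l.
Proof.
rewrite cluster_cvgE => -[G PG [Gzs zG]] hc hl.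
have h1 : h @ G --> h zs by apply: cvg_trans hc; exact: cvg_app Gzs.
have h2 : h @ G --> l.
  by move=> U /hl Ul; apply: zG.
exact: cvg_unique h1 h2.
Qed.

Lemma decrease_cvg (R : realType) (f g : nat -> R) (c b : R) :
  0 < c -> (forall k, b <= f k) -> (forall k, 0 <= g k) ->
  (forall k, f k.+1 - f k <= - (c * g k ^+ 2)) ->
  [/\ nonincreasing_seq f, exists l : R, f @ \oo --> l & g @ \oo --> (0 : R)].
Proof.
move=> c0 fb g0 dec.
have ni : nonincreasing_seq f.
  apply/nonincreasing_seqP => k; rewrite -subr_le0.
  by apply: le_trans (dec k) _; rewrite oppr_le0 mulr_ge0 ?sqr_ge0// ltW.
have fl : f @ \oo --> limn f.
  by apply: nonincreasing_is_cvgn => //; exists b => _ [k _ <-].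
split=> //; first by exists (limn f).
have d0 : (fun k => c^-1 * (f k - f k.+1)) @ \oo --> c^-1 * (limn f - limn f).
  apply: cvgM; first exact: cvg_cst.
  by apply: cvgB => //; rewrite cvg_shiftS.
have g2 : (fun k => g k ^+ 2) @ \oo --> (0 : R).
  rewrite subrr mulr0 in d0; apply: squeeze_cvgr (cvg_cst (0 : R)) d0.
  near=> k; rewrite sqr_ge0 ler_pdivlMl//=.
  by have := dec k; lra.
have -> : g = fun k => Num.sqrt (g k ^+ 2).
  by apply/funext => k; rewrite sqrtr_sqr ger0_norm.
rewrite -[X in _ --> X]sqrtr0.
exact: continuous_cvg _ (@sqrt_continuous R 0) g2.
Unshelve. all: by end_near. Qed.

(** * Stationary points and convergence *)

Section Stationarity.
Variables (R : realType) (m n : nat) (A : biquadratic_tensor R m n).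

Lemma sum_delta N (F : 'I_N -> R) k :
  \sum_i F i * (delta_mx k 0 : 'cV[R]_N) i 0 = F k.
Proof.
rewrite (bigD1 k)//= mxE !eqxx mulr1 big1 ?addr0// => i /negPf ik.
by rewrite mxE ik mulr0.
Qed.

Lemma multiform_delta1 i b c d : multiform A (delta_mx i 0) b c d =
  \sum_(i2 < m) \sum_(j1 < n) \sum_(j2 < n)
    A i j1 i2 j2 * b j1 0 * c i2 0 * d j2 0.
Proof.
rewrite multiformE [RHS]exchange_big/= -[RHS](sum_delta (fun i1 => \sum_j1
  \sum_i2 \sum_j2 A i1 j1 i2 j2 * b j1 0 * c i2 0 * d j2 0) i).
apply: eq_bigr => i1 _; rewrite mulr_suml; apply: eq_bigr => j1 _.
rewrite mulr_suml; apply: eq_bigr => i2 _; rewrite mulr_suml.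
by apply: eq_bigr => j2 _; ring.
Qed.

Lemma multiform_delta2 j a c d : multiform A a (delta_mx j 0) c d =
  \sum_(i1 < m) \sum_(i2 < m) \sum_(j2 < n)
    A i1 j i2 j2 * a i1 0 * c i2 0 * d j2 0.
Proof.
rewrite multiformE; apply: eq_bigr => i1 _.
rewrite -[RHS](sum_delta (fun j1 =>
  \sum_i2 \sum_j2 A i1 j1 i2 j2 * a i1 0 * c i2 0 * d j2 0) j).
apply: eq_bigr => j1 _; rewrite mulr_suml; apply: eq_bigr => i2 _.
by rewrite mulr_suml; apply: eq_bigr => j2 _; ring.
Qed.

Lemma multiform_delta3 i a b d : multiform A a b (delta_mx i 0) d =
  \sum_(i1 < m) \sum_(j1 < n) \sum_(j2 < n)
    A i1 j1 i j2 * a i1 0 * b j1 0 * d j2 0.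
Proof.
rewrite multiformE; apply: eq_bigr => i1 _; apply: eq_bigr => j1 _.
rewrite -[RHS](sum_delta (fun i2 =>
  \sum_j2 A i1 j1 i2 j2 * a i1 0 * b j1 0 * d j2 0) i).
apply: eq_bigr => i2 _; rewrite mulr_suml.
by apply: eq_bigr => j2 _; ring.
Qed.

Lemma multiform_delta4 j a b c : multiform A a b c (delta_mx j 0) =
  \sum_(i1 < m) \sum_(i2 < m) \sum_(j1 < n)
    A i1 j1 i2 j * a i1 0 * b j1 0 * c i2 0.
Proof.
rewrite multiformE; apply: eq_bigr => i1 _.
rewrite [RHS]exchange_big/=; apply: eq_bigr => j1 _; apply: eq_bigr => i2 _.
rewrite -[RHS](sum_delta
  (fun j2 => A i1 j1 i2 j2 * a i1 0 * b j1 0 * c i2 0) j).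
by apply: eq_bigr => j2 _; ring.
Qed.

(** At a feasible point with vanishing gradient, the multipliers are zero and
    the block equations of an M-eigenpair are those of the gradient. *)
Lemma stationary_M_eigenpair (z : 'cV[R]_(m + n)) : on_spheres z ->
  gradient (objective A) z = 0 ->
  kkt_point A z /\
  M_eigenpair A (biquad A (usubmx z) (dsubmx z)) (usubmx z) (dsubmx z).
Proof.
move=> zS g0; case: (zS) => x1 y1.
have d0 v : dobjective A z v = 0.
  by rewrite -dotv_gradient// g0 dotvC dotv0r.
have [T1 T2 T3 T4] := multiform0 A.
have dotv_delta N (w : 'cV[R]_N) i : dotv w (delta_mx i 0) = w i 0.
  by rewrite dotvE sum_delta.
split.
  split; first by rewrite /feasible /constr_x /constr_y x1 y1 subrr.
  by exists 0, 0; rewrite g0 !scale0r addr0.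
split=> // [i|j].
- have := d0 (col_mx (delta_mx i 0) 0).
  rewrite /dobjective /dbiquad col_mxKu col_mxKd T2 T4 dotv0r dotv_delta.
  by rewrite multiform_delta1 multiform_delta3; lra.
- have := d0 (col_mx 0 (delta_mx j 0)).
  rewrite /dobjective /dbiquad col_mxKu col_mxKd T1 T3 dotv0r dotv_delta.
  by rewrite multiform_delta2 multiform_delta4; lra.
Qed.

End Stationarity.

Theorem theorem6p4 (R : realType) (m n : nat) (A : biquadratic_tensor R m n)
    (eta beta CL CU : R) :
  (2 <= m)%N -> (2 <= n)%N ->
  0 < eta -> eta < 2 ->
  0 < beta -> beta < 1 ->
  0 < CL -> CL <= 1 -> 1 <= CU ->
  let f := objective A in
  exists M : R,
    [/\ 0 < M,
        forall z : 'cV[R]_(m + n),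
          dotv (usubmx z) (usubmx z) = 1 -> dotv (dsubmx z) (dsubmx z) = 1 ->
          [/\ `|f z| <= M,
              l2norm (gradient f z) <= M &
              spectral_norm (hessian f z) <= M] &
        let alpha_hat := (2 - eta) * CL / ((2 + eta) * M * CU ^+ 2) in
        let alpha_min := beta * alpha_hat in
        forall (ell : nat) (kappa : R) (gamma : nat -> R)
               (z : nat -> 'cV[R]_(m + n)),
          generated_by_rlbfgs A eta beta CL CU ell kappa gamma z ->
          [/\ forall k : nat,
                f (z k.+1) - f (z k) <=
                  - (eta * alpha_min * CL * l2norm (gradient f (z k)) ^+ 2),
              nonincreasing_seq (fun k => f (z k)),
              exists c : R, (fun k => f (z k)) @ \oo --> c,
              (fun k => l2norm (gradient f (z k))) @ \oo --> (0 : R) &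
              forall zs : 'cV[R]_(m + n),
                cluster (z @ \oo) zs ->
                kkt_point A zs /\
                M_eigenpair A (biquad A (usubmx zs) (dsubmx zs))
                  (usubmx zs) (dsubmx zs)]].
Proof.
move=> m2 n2 eta0 eta2 beta0 beta1 CL0 CL1 CU1 f.
have mn0 : (0 < m + n)%N by rewrite addn_gt0 (ltnW m2).
have rf := regular_objective A; rewrite -/f in rf.
have [KG KG0 hG] := gradient_bounded rf.
have [KH KH0 hH] := hessian_bounded rf mn0.
have K0 := entry_sum_ge0 A.
pose M := 1 + 48 * entry_sum A + KG + KH.
have M1 : 1 <= M by rewrite /M; lra.
have MK : 48 * entry_sum A <= M by rewrite /M; lra.
have MG : KG <= M by rewrite /M; lra.
have MH : KH <= M by rewrite /M; lra.
have hGM z : on_spheres z -> l2norm (gradient f z) <= M.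
  by move=> zS; exact: le_trans (hG z zS) MG.
exists M; split.
- by lra.
- move=> z x1 y1; have zS : on_spheres z by [].
  split; [|exact: hGM|exact: le_trans (hH z zS) MH].
  by apply: le_trans (objective_le_entry_sum A zS) _; lra.
move=> alpha_hat alpha_min ell kappa gamma z [x0 y0 step].
have C1 : 1 <= CU ^+ 2 by exact: exprn_ege1.
have den1 : 2 <= (2 + eta) * M * CU ^+ 2.
  have h1 : 2 * 1 <= (2 + eta) * M by apply: ler_pM => //; lra.
  have : 2 * 1 <= (2 + eta) * M * CU ^+ 2 by apply: ler_pM => //; lra.
  by rewrite mulr1.
have hat0 : 0 < alpha_hat.
  by rewrite /alpha_hat divr_gt0 ?mulr_gt0//; lra.
have hat1 : alpha_hat <= 1.
  rewrite /alpha_hat ler_pdivrMr ?mul1r; last by lra.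
  by apply: le_trans den1; nra.
have min0 : 0 < alpha_min by rewrite mulr_gt0.
have zS k : on_spheres (z k).
  elim: k => [|k ih]; first by split; exact: unit_l2norm.
  by have [j [_ _ ->]] := step k; exact: trial_point_on_spheres.
have dec k : f (z k.+1) - f (z k) <=
    - (eta * alpha_min * CL * l2norm (gradient f (z k)) ^+ 2).
  have := step k; cbv zeta; rewrite -/f.
  set p := search_direction _ _ _ _ => -[j [arm rej zE]].
  have [px py] : block_descent CL CU (usubmx p) (usubmx (gradient f (z k))) /\
      block_descent CL CU (dsubmx p) (dsubmx (gradient f (z k))).
    exact: search_direction_descent.
  have bj : alpha_min <= beta ^+ j.
    case: j rej {arm zE} => [_|j rej].
      by rewrite expr0 /alpha_min; nra.
    rewrite exprS /alpha_min ler_pM2l// leNgt; apply/negP => /ltW small.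
    have /negP[] := rej j (ltnSn j).
    apply: (armijo_small_step eta0 eta2 CL0 CL1 CU1 M1 MK) => //.
    - exact: hGM.
    - by rewrite exprn_gt0.
  have CU0 : 0 <= CU by lra.
  have [slx _] := block_descentP CU0 px; have [sly _] := block_descentP CU0 py.
  move: arm; rewrite /armijo -zE -/f => arm.
  have slope : dotv p (gradient f (z k)) <=
      - (CL * l2norm (gradient f (z k)) ^+ 2).
    rewrite !sqr_l2norm in slx sly *.
    by rewrite (dotv_split p) (dotv_split (gradient f (z k))); lra.
  have G0 : 0 <= CL * l2norm (gradient f (z k)) ^+ 2.
    by rewrite mulr_ge0 ?sqr_ge0// ltW.
  have b0 : 0 <= eta * beta ^+ j by rewrite mulr_ge0 ?exprn_ge0// ltW.
  have h1 := ler_wpM2l b0 slope.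
  have h2 := ler_wpM2r G0 (ler_wpM2l (ltW eta0) bj).
  by lra.
have c0 : 0 < eta * alpha_min * CL by apply: mulr_gt0 => //; exact: mulr_gt0.
have fb k : - M <= f (z k).
  have := objective_le_entry_sum A (zS k); rewrite ler_norml => /andP[h _].
  by apply: le_trans h; lra.
have [ni fl gl] := decrease_cvg c0 fb
  (fun k => l2norm_ge0 (gradient f (z k))) dec.
split=> // zs czs.
have zsS : on_spheres zs.
  split.
  - apply: (cluster_continuous_limit czs (@continuous_sqr_norm_x R m n zs)).
    rewrite (_ : (fun k => _) = cst 1); first exact: cvg_cst.
    by apply/funext => k; case: (zS k).
  - apply: (cluster_continuous_limit czs (@continuous_sqr_norm_y R m n zs)).
    rewrite (_ : (fun k => _) = cst 1); first exact: cvg_cst.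
    by apply/funext => k; case: (zS k).
apply: stationary_M_eigenpair => //; apply/colP => i; rewrite [RHS]mxE.
apply: (cluster_continuous_limit czs (@continuous_gradient _ _ _ _ rf i _ zsS)).
apply/cvgr0Pnorm_le => e e0; near=> k.
apply: le_trans (coord_le_l2norm _ _) _.
rewrite -[leLHS]ger0_norm ?l2norm_ge0//.
by near: k; move/cvgr0Pnorm_le : gl => /(_ e e0).
Unshelve. all: by end_near. Qed.
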